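(* Let $q$ be a real-valued function on databases with global sensitivity $\Delta$, and let $Z$ be a standard Gaussian random variable. Let $\delta \in (0,1)$ and $\epsilon > 0$, let $\Phi^{-1}$ be the standard Gaussian quantile function, and set $$b = \frac{\Delta}{2\epsilon}\left(\Phi^{-1}(1-\delta) + \sqrt{\left(\Phi^{-1}(1-\delta)\right)^2 + 2\epsilon}\right)$$ and $$(a,s) = \begin{cases} (1,1), & 0 < \delta \le \tfrac12,\\ (\tfrac{\pi}{4}, -1), & \tfrac12 \le \delta < 1\end{cases}$$ (at $\delta = \tfrac12$ either choice of $(a,s)$ may be used). Then, for every $\sigma \ge b$, the mechanism that on input a database $d$ returns a variate of $q(d) + \sigma Z$ is $(\epsilon,\delta)$-differentially private. Moreover, $$b \;\le\; \frac{\Delta}{\epsilon\sqrt2}\left(\sqrt{a\log\left(\frac{1}{4\delta(1-\delta)}\right)+\epsilon} + s\sqrt{a\log\left(\frac{1}{4\delta(1-\delta)}\right)}\right) \;\le\; \frac{\Delta}{\epsilon\sqrt2}(1+s)\sqrt{a\log\left(\frac{1}{4\delta(1-\delta)}\right)} + \frac{\Delta}{\sqrt{2\epsilon}}.$$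
   Context: A database is a (finite) collection of record values from some set $V$. Two databases $d, d'$ are neighboring if one can be obtained from the other by adding one record; $\mathcal{N}$ denotes the set of all (ordered, in either order) pairs $(d,d')$ of neighboring databases. The global sensitivity of a real-valued function $q$ on databases is $\Delta = \max_{(d,d')\in\mathcal{N}} |q(d)-q(d')|$ (assumed to exist as a finite real number). A randomized algorithm $M$ is $(\epsilon,\delta)$-differentially private if for every measurable set $S$ of possible outputs and all $(d,d')\in\mathcal{N}$, $\Pr(M(d)\in S) \le e^{\epsilon}\Pr(M(d')\in S)+\delta$, where the probabilities are over the randomness used in $M$. Here outputs are real numbers and $S$ ranges over measurable subsets of $\mathbb{R}$. $\log$ is the natural logarithm. *)

(* Defs.v *)
From HB Require Import structures.
From mathcomp Require Export all_boot all_order all_algebra.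
From mathcomp Require Export all_classical all_reals all_analysis.
From mathcomp Require Export measurable_realfun finmap multiset.

Set Implicit Arguments.
Unset Strict Implicit.
Unset Printing Implicit Defensive.

Export Order.TTheory GRing.Theory Num.Theory.
Export numFieldNormedType.Exports.

Local Open Scope classical_set_scope.
Local Open Scope ring_scope.

(* A finite collection of records is a multiset: repetitions count, order does
   not. *)
Definition database (V : choiceType) := {mset V}%mset.

Definition neighboring (V : choiceType) : set (database V * database V) :=
  [set p | exists v : V,
     (p.1 = v +` p.2 :> database V)%mset \/ (p.2 = v +` p.1 :> database V)%mset].

(* A maximum, not merely a supremum: the value [Delta] is attained. *)
Definition global_sensitivity (R : realType) (V : choiceType)
    (q : database V -> R) (Delta : R) : Prop :=
  let gaps := [set `|q p.1 - q p.2| | p in @neighboring V] in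
  gaps Delta /\ ubound gaps Delta.

(* A real-valued randomized algorithm is a family of random variables, indexed
   by the input database, on the probability space carrying its randomness. *)
Definition differentially_private (R : realType) (V : choiceType)
    (d : measure_display) (T : measurableType d) (P : probability T R)
    (epsilon delta : R) (M : database V -> {RV P >-> R}) : Prop :=
  forall S : set R, measurable S ->
  forall x y : database V, neighboring (x, y) ->
  (P (M x @^-1` S) <= (expR epsilon)%:E * P (M y @^-1` S) + delta%:E)%E.

(* The two laws are compared on Borel sets only: [distribution P Z] and
   [normal_prob 0 1] also take values, without meaning, on other sets. *)
Definition standard_gaussian (R : realType)
    (d : measure_display) (T : measurableType d) (P : probability T R)
    (Z : {RV P >-> R}) : Prop :=
  forall S : set R, measurable S ->
  distribution P Z S = normal_prob 0 1 S.

Definition gaussian_cdf (R : realType) (x : R) : R :=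
  fine (normal_prob 0 1 `]-oo, x]).

(* The usual quantile function; for 0 < p < 1 it inverts [gaussian_cdf]. *)
Definition gaussian_quantile (R : realType) (p : R) : R :=
  inf [set x : R | p <= gaussian_cdf x].

Definition gaussian_mechanism (R : realType) (V : choiceType)
    (d : measure_display) (T : measurableType d) (P : probability T R)
    (Z : {RV P >-> R}) (q : database V -> R) (sigma : R)
    (x : database V) : {RV P >-> R} :=
  cst (q x) \+ cst sigma \* Z.

(* Main.v *)
From HB Require Import structures.
Require Import Defs.
From mathcomp Require Import ring lra.

(** Privacy: with [c = (q x - q y) / sigma], the two output densities at the
    noise value [t] have ratio [exp (c t + c^2 / 2)], so it is enough that the
    event [epsilon < c t + c^2 / 2] has Gaussian probability at most [delta].
    It is a half-line tail, and [b] is the larger root of the quadratic equation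
    in [sigma] that puts its end point at the [1 - delta] quantile.

    Bounds on [b]: [u + sqrt (u^2 + epsilon)] is increasing in [u], so one only
    has to bound the quantile, and with [G x = P (|Z| <= x)] this amounts to
      [1 - exp (- x^2 / 2) <= G x ^ 2 <= 1 - exp (- 2 x^2 / pi)].
    Geometrically a square is compared with its inscribed disc and with the disc
    of the same area; here both inequalities come from one-variable calculus: a
    function vanishing at 0 and at infinity is nonnegative if its derivative
    changes sign at most once, from positive to negative, and this sign pattern
    is traced through the derivatives until it is obvious. *)

Local Open Scope classical_set_scope.
Local Open Scope ring_scope.

(** * Translation and reflection of the Gaussian law *)

Lemma measurable_shift {R : realType} (c : R) :
  measurable_fun setT
    ((fun x => x + c) : measurableTypeR R -> measurableTypeR R).
Proof. exact: measurable_funD. Qed.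

(** By uniqueness of Lebesgue measure, only half-open intervals have to be checked. *)
Lemma lebesgue_measure_shift {R : realType} (c : R) (A : set R) :
  measurable A ->
  pushforward lebesgue_measure
    ((fun x => x + c) : measurableTypeR R -> measurableTypeR R) A =
  lebesgue_measure A.
Proof.
move=> mA; have mf := measurable_shift c.
apply/esym/lebesgue_measure_unique => //= _ [[a b]] _ <-.
rewrite /pushforward /=.
have -> : (fun x => x + c) @^-1` `]a, b] = [set` `]a - c, b - c]].
  by apply/seteqP; split => x /=; rewrite !in_itv/= ltrBlDr lerBrDr.
rewrite !lebesgue_measure_itv/= !lte_fin ltrD2r; case: ifP => // _.
by rewrite -!EFinD; congr EFin; ring.
Qed.

Lemma measurable_normal_pdfE {R : realType} (m s : R)
    (A : set (measurableTypeR R)) :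
  measurable_fun A (fun x => (normal_pdf m s x)%:E).
Proof.
apply/measurable_EFinP; apply: measurable_funTS.
exact: measurable_normal_pdf.
Qed.

Lemma normal_prob_shift {R : realType} (m s c : R) (A : set R) :
  measurable A ->
  (normal_prob m s A =
   \int[lebesgue_measure]_(x in (fun x => (x + c)%R) @^-1` A)
     (normal_pdf m s (x + c))%:E)%E.
Proof.
move=> mA; rewrite /normal_prob.
have mf := measurable_shift c.
rewrite -(ge0_integral_pushforward mf lebesgue_measure mA
  (f := fun x => (normal_pdf m s x)%:E)).
- apply: eq_measure_integral => //= B mB _.
  exact/esym/lebesgue_measure_shift.
- exact: measurable_normal_pdfE.
- by move=> x _; rewrite lee_fin normal_pdf_ge0.
Qed.

Lemma normal_pdf01E {R : realType} (x : R) :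
  normal_pdf 0 1 x = normal_peak 1 * expR (- x ^+ 2 / 2).
Proof. by rewrite normal_pdfE ?oner_eq0// /normal_fun subr0 expr1n. Qed.

Lemma normal_prob01N {R : realType} (A : set R) :
  measurable A -> normal_prob 0 1 (-%R @^-1` A) = normal_prob 0 1 A.
Proof.
move=> mA; rewrite /normal_prob.
have mf : measurable_fun setT
  (-%R : measurableTypeR R -> measurableTypeR R) by [].
have E : (\int[lebesgue_measure]_(x in -%R @^-1` A) (normal_pdf 0 1 x)%:E =
    \int[lebesgue_measure]_(x in -%R @^-1` A)
      ((fun x => (normal_pdf 0 1 x)%:E) \o (-%R : R -> R)) x)%E.
  by apply: eq_integral => x _ /=; rewrite !normal_pdf01E sqrrN.
rewrite E -(ge0_integral_pushforward mf lebesgue_measure mA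
  (f := fun x => (normal_pdf 0 1 x)%:E)).
- by apply: eq_measure_integral => //= B mB _; exact: lebesgue_measureN.
- exact: measurable_normal_pdfE.
- by move=> x _; rewrite lee_fin normal_pdf_ge0.
Qed.

(** * Density ratio of a shifted Gaussian *)

Lemma normal_pdf01_shift {R : realType} (c x : R) :
  normal_pdf 0 1 x = expR (c * x + c ^+ 2 / 2) * normal_pdf 0 1 (x + c).
Proof.
rewrite !normal_pdf01E mulrCA -expRD; by congr (_ * expR _); field.
Qed.

Lemma measurable_loss_event {R : realType} (c epsilon : R) :
  measurable [set x : R | epsilon < c * x + c ^+ 2 / 2].
Proof.
have -> : [set x : R | epsilon < c * x + c ^+ 2 / 2] =
    setT `&` (fun x => c * x + c ^+ 2 / 2) @^-1` `]epsilon, +oo[.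
  by rewrite setTI; apply/seteqP; split => x /=; rewrite in_itv/= andbT.
have mloss : measurable_fun setT ((fun x => c * x + c ^+ 2 / 2) : R -> R).
  by apply: measurable_funD => //; exact: measurable_funM.
exact: mloss.
Qed.

(** The preimage [B] is cut along the event [bad]. Off [bad] the density ratio is at most
    [expR epsilon], and the integral may then be enlarged from [B] minus [bad] to [B]; the mass of
    [bad] is paid in full as the additive term. *)
Lemma normal_prob01_shift_le {R : realType} (c epsilon : R) (A : set R) :
  measurable A ->
  (normal_prob 0 1 ((fun x => (x + c)%R) @^-1` A) <=
   (expR epsilon)%:E * normal_prob 0 1 A +
   normal_prob 0 1 [set x | epsilon < c * x + c ^+ 2 / 2]%R)%E.
Proof.
move=> mA.
set B := (fun x => x + c) @^-1` A; set bad := [set x | _].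
have mB : measurable B.
  by rewrite -[B]setTI; exact: measurable_shift.
have mbad : measurable bad := measurable_loss_event c epsilon.
have mBb : measurable (B `\` bad) by exact: measurableD.
apply: (@le_trans _ _ (normal_prob 0 1 (B `\` bad) + normal_prob 0 1 bad)%E).
  rewrite -measureU//=; last by apply/seteqP; split => x // -[[]].
  apply: le_measure; try apply: mem_set => //.
  - exact: measurableU.
  - by move=> x Bx; have [?|?] := pselect (bad x); [right|left].
have mfc D : measurable_fun (D : set (measurableTypeR R))
    (fun x => (normal_pdf 0 1 (x + c))%:E).
  apply: measurable_funTS.
  exact: (measurableT_comp (measurable_normal_pdfE 0 1 setT)
                           (measurable_shift c)).
apply: leeD => //; rewrite (normal_prob_shift 0 1 c A mA) -/B -ge0_integralZl//;
  try by move=> x _; rewrite lee_fin normal_pdf_ge0.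
apply: (@le_trans _ _ (\int[lebesgue_measure]_(x in B `\` bad)
    ((expR epsilon)%:E * (normal_pdf 0 1 (x + c))%:E))%E).
  apply: ge0_le_integral => //=.
  - by move=> x _; rewrite lee_fin normal_pdf_ge0.
  - exact: measurable_normal_pdfE.
  - exact: measurable_funeM.
  - move=> x [_ /negP]; rewrite -leNgt => h.
    rewrite -EFinM lee_fin (normal_pdf01_shift c).
    by rewrite ler_wpM2r ?normal_pdf_ge0 ?ler_expR.
apply: ge0_subset_integral => //.
- exact: measurable_funeM.
- by move=> x _; rewrite mule_ge0// lee_fin ?normal_pdf_ge0 ?expR_ge0.
Qed.

(** * Gaussian distribution function and quantile *)

Lemma gaussian_cdfE {R : realType} (x : R) :
  normal_prob 0 1 `]-oo, x] = (gaussian_cdf x)%:E.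
Proof.
rewrite /gaussian_cdf fineK// fin_num_measure//.
Qed.

Lemma gaussian_ccdfE {R : realType} (x : R) :
  normal_prob 0 1 `]x, +oo[ = (1 - gaussian_cdf x)%:E.
Proof.
rewrite -setCitvl probability_setC//= ?gaussian_cdfE//.
Qed.

Lemma is_derive_gaussian_cdf {R : realType} (x : R) :
  is_derive x 1 (@gaussian_cdf R) (normal_pdf 0 1 x).
Proof.
suff [dF <-] : derivable (@gaussian_cdf R) x 1 /\
    ((@gaussian_cdf R)^`())%classic x = normal_pdf 0 1 x.
  by apply: DeriveDef => //; rewrite derive1E.
(* The integral starts at minus infinity; [x + 1] is just some right end point beyond [x]. *)
apply: (@continuous_FTC1 R (normal_pdf 0 1) -oo%O x (x + 1)).
- by rewrite ltrDl.
- by apply: integrableS (integrable_normal_pdf 0 1).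
- exact: ltNyr.
- exact: continuous_normal_pdf.
Qed.

Lemma gaussian_cdfN {R : realType} (x : R) :
  gaussian_cdf (- x) = 1 - gaussian_cdf x.
Proof.
apply: EFin_inj; rewrite -gaussian_ccdfE -gaussian_cdfE.
have -> : [set` `]-oo, - x]] = -%R @^-1` [set` `[x, +oo[].
  by rewrite opp_preimage_itvbndy.
rewrite normal_prob01N// /normal_prob.
by rewrite integral_itv_obnd_cbnd//; exact: measurable_normal_pdfE.
Qed.

Lemma gaussian_cdf_cvgy1 {R : realType} (e x : R) : 0 < e ->
  exists2 y, x <= y & 1 - e < gaussian_cdf y.
Proof.
move=> e0.
(* The identity, as a random variable under the normal law itself, has [gaussian_cdf] as its cdf, so
   the general limit at infinity applies. *)
pose X : measurableTypeR R -> R := idfun.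
pose mX := @isMeasurableFun.Build _ _ _ _ X (@measurable_id _ _ setT).
pose HX : {RV (normal_prob 0 1 : probability _ R) >-> R} := HB.pack X mX.
have cdfE : cdf HX = EFin \o @gaussian_cdf R.
  by apply/funext => y; rewrite /= -gaussian_cdfE.
have := @cvg_cdfy1 _ _ _ _ HX; rewrite cdfE => /fine_cvgP[_ /cvgr_gt].
move=> /(_ (1 - e)); rewrite ltrBlDr ltrDl => /(_ e0) near_gt.
near (pinfty_nbhs R) => y; exists y; last by near: y; exact: near_gt.
by near: y; apply: nbhs_pinfty_ge; exact: num_real.
Unshelve. all: by end_near. Qed.

Lemma derivable_gaussian_cdf {R : realType} (x : R) :
  derivable (@gaussian_cdf R) x 1.
Proof. by have [] := is_derive_gaussian_cdf x. Qed.

Lemma gaussian_cdf_lt {R : realType} : {homo @gaussian_cdf R : x y / x < y}.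
Proof.
move=> x y xy.
apply: (@gtr0_derive1_lt_cc _ _ x y) => //; rewrite ?in_itv/= ?lexx ?ltW//.
- by move=> z _; exact: derivable_gaussian_cdf.
- move=> z _; rewrite derive1E; have [_ ->] := is_derive_gaussian_cdf z.
  by rewrite normal_pdf01E mulr_gt0 ?expR_gt0 ?normal_peak_gt0 ?oner_eq0.
- by apply: derivable_within_continuous => z _; exact: derivable_gaussian_cdf.
Qed.

Lemma gaussian_quantileK {R : realType} (p : R) : 0 < p -> p < 1 ->
  gaussian_cdf (gaussian_quantile p) = p.
Proof.
move=> p0 p1.
have [b _ pb] := @gaussian_cdf_cvgy1 R (1 - p) 0 (ltac:(by rewrite subr_gt0)).
(* By symmetry, [gaussian_cdf a > 1 - p] means [gaussian_cdf (- a) < p], so [- a] and [b] bracket a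
   solution. *)
have [a _ pa] := gaussian_cdf_cvgy1 _ b p0.
have ab : - a <= b.
  rewrite leNgt; apply/negP => /gaussian_cdf_lt; rewrite gaussian_cdfN; lra.
have [||c _ cp] := @IVT R (@gaussian_cdf R) (- a) b p ab.
- by apply: derivable_within_continuous => z _; exact: derivable_gaussian_cdf.
- rewrite ge_min le_max gaussian_cdfN.
  by apply/andP; split; apply/orP; [left|right]; lra.
suff -> : gaussian_quantile p = c by [].
rewrite /gaussian_quantile (_ : mkset _ = [set` `[c, +oo[]) ?inf_itv//.
apply/seteqP; split => x /=; rewrite in_itv/= andbT -cp.
  by rewrite !leNgt; apply: contra => /gaussian_cdf_lt.
by rewrite le_eqVlt => /predU1P[->//|/gaussian_cdf_lt/ltW].
Qed.

(** * Tracing a sign pattern through derivatives *)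

(* Once [f] is negative it is nonincreasing, hence stays negative. *)
Definition stays_down {R : realType} (f : R -> R) :=
  forall x, 0 <= x -> 0 <= f x \/ forall y, x <= y -> f y <= f x.

(** If [f x >= 0], then [f] is nonnegative on all of [[0, x]], so [F x >= F 0 >= 0]. If [f x < 0],
    then [f] stays negative and [F] is nonincreasing beyond [x]. The weight [w] lets a nonnegative
    factor be dropped from a derivative before differentiating again. *)
Lemma stays_down_primitive {R : realType} (F f w : R -> R) :
  (forall x : R, is_derive x 1 F (w x * f x)) ->
  (forall x, 0 <= x -> 0 <= w x) ->
  0 <= F 0 -> stays_down f -> stays_down F.
Proof.
move=> dF w0 F0 df x x0.
have dF1 z : derivable F z 1 by have [] := dF z.
have F'E z : (F^`())%classic z = w z * f z.
  by rewrite derive1E; have [_ ->] := dF z.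
have cF (i : interval R) : {within [set` i], continuous F}.
  by apply: derivable_within_continuous => z _.
have [fx0|fx0] := leP 0 (f x); [left|right].
  apply: (le_trans F0); apply: (@ger0_derive1_le_cc _ F 0 x) => //.
  - move=> z; rewrite in_itv/= => /andP[z0 zx].
    rewrite F'E mulr_ge0 ?(w0 _ (ltW z0))//.
    by have [|/(_ _ (ltW zx))] := df z (ltW z0); last exact: le_trans fx0.
  - by rewrite in_itv/= lexx.
  - by rewrite in_itv/= lexx x0.
move=> y xy; apply: (@ler0_derive1_le_cc _ F x y) => //.
- move=> z; rewrite in_itv/= => /andP[xz _]; rewrite F'E mulr_ge0_le0 ?w0//.
    exact: le_trans (ltW xz).
  have [|/(_ _ (ltW xz)) fzx] := df x x0; first by rewrite leNgt fx0.
  exact: le_trans fzx (ltW fx0).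
- by rewrite in_itv/= lexx xy.
- by rewrite in_itv/= lexx xy.
Qed.

Lemma stays_down_ge0 {R : realType} (F : R -> R) (x : R) :
  stays_down F ->
  (forall e, 0 < e -> exists2 y, x <= y & - e < F y) ->
  0 <= x -> 0 <= F x.
Proof.
move=> dF limF x0; have [//|Fdec] := dF x x0.
rewrite leNgt; apply/negP => Fx0.
have [y xy] := limF (- F x) (ltac:(by rewrite oppr_gt0)).
by rewrite opprK ltNge Fdec.
Qed.

Lemma is_derive_gauss {R : realType} (k x : R) :
  is_derive x 1 (fun y => expR (k * y ^+ 2)) (2 * k * x * expR (k * x ^+ 2)).
Proof.
apply: is_derive_eq; rewrite /GRing.scale/=; ring.
Qed.

(** * Two-sided Gaussian bounds *)

(** For [0 <= x] this is [G x] of the overview; the formula extends it to an odd function. *)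
Definition central_prob {R : realType} (x : R) := 2 * gaussian_cdf x - 1.

Lemma is_derive_central_prob {R : realType} (x : R) :
  is_derive x 1 central_prob (2 * normal_peak 1 * expR (- 2^-1 * x ^+ 2)).
Proof.
have dPhi := is_derive_gaussian_cdf x.
apply: is_derive_eq; rewrite normal_pdf01E subr0 /GRing.scale/= mulrA.
by congr (_ * expR _); ring.
Qed.

Lemma gaussian_cdf0 {R : realType} : gaussian_cdf (0 : R) = 2^-1.
Proof. have := gaussian_cdfN (0 : R); rewrite oppr0; lra. Qed.

Lemma gaussian_cdf_ge0 {R : realType} (x : R) : 0 <= gaussian_cdf x.
Proof. by rewrite fine_ge0. Qed.

Lemma gaussian_cdf_le1 {R : realType} (x : R) : gaussian_cdf x <= 1.
Proof. by rewrite -lee_fin -gaussian_cdfE probability_le1. Qed.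

Lemma central_prob0 {R : realType} : central_prob (0 : R) = 0.
Proof. rewrite /central_prob gaussian_cdf0; lra. Qed.

Lemma central_probN {R : realType} (x : R) :
  central_prob (- x) = - central_prob x.
Proof. rewrite /central_prob gaussian_cdfN; lra. Qed.

Lemma sqr_normal_peak1 {R : realType} : (normal_peak 1 : R) ^+ 2 = (2 * pi)^-1.
Proof.
rewrite /normal_peak expr1n mul1r exprVn sqr_sqrtr ?mulr_natl//.
by rewrite mulrn_wge0// pi_ge0.
Qed.

Lemma stays_down_nonincreasing {R : realType} (f : R -> R) :
  (forall x y, 0 <= x -> x <= y -> f y <= f x) -> stays_down f.
Proof. by move=> h x x0; right => y; exact: h. Qed.

Lemma expR_sqr_nonincreasing {R : realType} (k x y : R) :
  k <= 0 -> 0 <= x -> x <= y -> expR (k * y ^+ 2) <= expR (k * x ^+ 2).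
Proof.
move=> k0 x0 xy; rewrite ler_expR ler_wnM2l// lerXn2r// nnegrE//.
exact: le_trans xy.
Qed.

(** [H] has derivative [expR (- y ^+ 2 / 2) * k y], and [k] has derivative [k'], which is visibly
    nonincreasing on the positive axis. *)
Lemma central_prob_sqr_ge {R : realType} (x : R) : 0 <= x ->
  1 - expR (- 2^-1 * x ^+ 2) <= central_prob x ^+ 2.
Proof.
move=> x0; rewrite -subr_ge0.
pose p : R := normal_peak 1.
pose H (y : R) := central_prob y ^+ 2 - (1 - expR (- 2^-1 * y ^+ 2)).
pose k (y : R) := 4 * p * central_prob y - y.
pose k' (y : R) := 8 * p ^+ 2 * expR (- 2^-1 * y ^+ 2) - 1.
apply: (@stays_down_ge0 _ H) => // [|e e0]; last first.
  (* With [e / 4], [central_prob y > 1 - e / 2], and [G ^ 2 >= 2 G - 1] then exceeds [1 - e]. *)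
  have [y xy Gy] := @gaussian_cdf_cvgy1 R (e / 4) x (ltac:(lra)).
  exists y => //; rewrite /H /central_prob.
  have := expR_gt0 (- 2^-1 * y ^+ 2); nra.
apply: (@stays_down_primitive _ H k (fun y => expR (- 2^-1 * y ^+ 2))).
- move=> y; have dG := is_derive_central_prob y.
  have dE := is_derive_gauss (- 2^-1) y.
  apply: is_derive_eq; by rewrite /k /p /GRing.scale/=; field.
- by move=> y _; exact: expR_ge0.
- by rewrite /H central_prob0 !expr0n/= mulr0 expR0 subrr subr0.
apply: (@stays_down_primitive _ k k' (fun _ => 1)).
- move=> y; have dG := is_derive_central_prob y.
  apply: is_derive_eq; rewrite /k' /p /GRing.scale/=; ring.
- by move=> y _; exact: ler01.
- by rewrite /k central_prob0 mulr0 subr0.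
apply: stays_down_nonincreasing => y z y0 yz; rewrite /k' lerD2r ler_wpM2l//.
  by rewrite mulr_ge0// sqr_ge0.
by apply: expR_sqr_nonincreasing => //; lra.
Qed.

Lemma expR_sqr_small {R : realType} (k e x : R) : k < 0 -> 0 < e -> 
  exists2 y, x <= y & expR (k * y ^+ 2) < e.
Proof.
move=> k0 e0.
have ke : 0 < (- k * e)^-1 by rewrite invr_gt0 mulr_gt0// oppr_gt0.
(* The last summand makes [- k * y] exceed [e^-1]; [1] ensures [y <= y ^+ 2], and the absolute value
   ensures [x <= y]. *)
exists (`|x| + 1 + (- k * e)^-1).
  by have := ler_norm x; lra.
set y := _ + _ + _; have y1 : 1 <= y by have := normr_ge0 x; rewrite /y; lra.
rewrite -[k]opprK mulNr expRN invf_plt ?posrE ?expR_gt0//.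
apply: lt_le_trans (expR_ge1Dx _).
have : e^-1 <= - k * y.
  rewrite -ler_pdivrMl ?oppr_gt0// -invfM; rewrite /y; have := normr_ge0 x; lra.
have : - k * y <= - k * y ^+ 2.
  by rewrite ler_pM2l ?oppr_gt0// expr2 ler_peMl// (le_trans ler01).
lra.
Qed.

(** The chain is [K], [m], [n], [n'], each function being the derivative of the previous one up to a
    nonnegative weight. The constant [2 / pi] is [4 * p ^+ 2], for which both sides agree to second
    order at 0. *)
Lemma central_prob_sqr_le {R : realType} (x : R) : 0 <= x ->
  central_prob x ^+ 2 <= 1 - expR (- (2 / pi) * x ^+ 2).
Proof.
move=> x0; rewrite -subr_ge0.
have pi2 : 2 / pi <= 1 :> R by rewrite ler_pdivrMr ?pi_gt0// mul1r pi_ge2.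
have pi_gt0 := @pi_gt0 R.
pose p : R := normal_peak 1.
have p_gt0 : 0 < p by rewrite normal_peak_gt0 ?oner_eq0.
(* [a] is the exponent left in the derivative of [K] once [expR (- y ^+ 2 / 2)] is factored out, and
   [b = 1 / 2 - a] the one left in that of [m]. The sign [b >= 0], from [pi >= 2], makes [n']
   nonincreasing. *)
pose a : R := 2 / pi - 2^-1.
pose b : R := 1 - 2 / pi.
pose K (y : R) := 1 - expR (- (2 / pi) * y ^+ 2) - central_prob y ^+ 2.
pose m (y : R) := 2 * p * y * expR (- a * y ^+ 2) - central_prob y.
pose n (y : R) := 1 - 2 * a * y ^+ 2 - expR (- b * y ^+ 2).
pose n' (y : R) := - 4 * a + 2 * b * expR (- b * y ^+ 2).
apply: (@stays_down_ge0 _ K) => // [|e e0]; last first.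
  have [y xy Ey] := @expR_sqr_small R (- (2 / pi)) e x
    (ltac:(by rewrite oppr_lt0 divr_gt0)) e0.
  exists y => //; rewrite /K /central_prob.
  by have := gaussian_cdf_le1 y; have := gaussian_cdf_ge0 y; nra.
apply: (@stays_down_primitive _ K m
    (fun y => 4 * p * expR (- 2^-1 * y ^+ 2))).
- move=> y; have dG := is_derive_central_prob y.
  have dE := is_derive_gauss (- (2 / pi)) y.
  apply: is_derive_eq; rewrite /m -/p /GRing.scale/=.
  have -> : expR (- (2 / pi) * y ^+ 2) =
      expR (- 2^-1 * y ^+ 2) * expR (- a * y ^+ 2).
    by rewrite -expRD /a; congr expR; ring.
  have -> : 2 / pi = 4 * p ^+ 2.
    by rewrite /p sqr_normal_peak1 invfM mulrA; congr (_ / _); lra.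
  ring.
- by move=> y _; rewrite !mulr_ge0 ?expR_ge0// ltW.
- by rewrite /K central_prob0 !expr0n/= mulr0 expR0 subrr subr0.
apply: (@stays_down_primitive _ m n
    (fun y => 2 * p * expR (- a * y ^+ 2))).
- move=> y; have dG := is_derive_central_prob y.
  have dE := is_derive_gauss (- a) y.
  apply: is_derive_eq; rewrite /n -/p /GRing.scale/=.
  have -> : expR (- 2^-1 * y ^+ 2) = expR (- a * y ^+ 2) * expR (- b * y ^+ 2).
    by rewrite -expRD /a /b; set c := 2 / pi; congr expR; field.
  ring.
- by move=> y _; rewrite !mulr_ge0 ?expR_ge0// ltW.
- by rewrite /m central_prob0 mulr0 mul0r subr0.
apply: (@stays_down_primitive _ n n' id).
- move=> y; have dE := is_derive_gauss (- b) y.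
  apply: is_derive_eq; rewrite /n' /GRing.scale/=; ring.
- by [].
- by rewrite /n !expr0n/= !mulr0 expR0 subr0 subrr.
apply: stays_down_nonincreasing => y z y0 yz.
have b0 : 0 <= b by rewrite subr_ge0.
rewrite /n' lerD2l ler_wpM2l//; first by rewrite mulr_ge0.
by apply: expR_sqr_nonincreasing; rewrite ?oppr_le0.
Qed.

(** * Noise calibration and privacy *)

(** For [c > 0] the event is a half-line whose end point is at least [z]; reflection reduces [c < 0]
    to this case. *)
Lemma normal_prob01_loss_tail {R : realType} (c epsilon z : R) :
  c != 0 -> `|c| * z + c ^+ 2 / 2 <= epsilon ->
  (normal_prob 0 1 [set x | epsilon < c * x + c ^+ 2 / 2]%R <=
   (1 - gaussian_cdf z)%:E)%E.
Proof.
move=> c0 hc; rewrite -gaussian_ccdfE.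
have pos k : 0 < k -> k * z + k ^+ 2 / 2 <= epsilon ->
    (normal_prob 0 1 [set x | epsilon < k * x + k ^+ 2 / 2]%R <=
     normal_prob 0 1 `]z, +oo[)%E.
  move=> k0 hk; apply: le_measure.
  - exact: mem_set (measurable_loss_event k epsilon).
  - exact: mem_set.
  move=> x /=; rewrite in_itv/= andbT => hx.
  by rewrite -(ltr_pM2l k0); lra.
have [cneg|cpos|] := ltgtP c 0; last by move/eqP; rewrite (negbTE c0).
- rewrite -(@normal_prob01N _ [set x | _]); last exact: measurable_loss_event.
  have -> : -%R @^-1` [set x | epsilon < c * x + c ^+ 2 / 2] =
      [set x | epsilon < - c * x + (- c) ^+ 2 / 2].
    by apply/seteqP; split => x /=; rewrite mulrN mulNr sqrrN.
  by apply: pos; [rewrite oppr_gt0|rewrite sqrrN -(ltr0_norm cneg)].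
- by apply: pos => //; rewrite -{1}(gtr0_norm cpos).
Qed.

Lemma normr_lt_sqrt {R : realType} (t e : R) :
  0 < e -> `|t| < Num.sqrt (t ^+ 2 + e).
Proof.
by move=> e0; rewrite -sqrtr_sqr ltr_sqrt ?ltrDl// ltr_wpDl// sqr_ge0.
Qed.

Lemma add_sqrt_sqr_le {R : realType} (epsilon u v : R) :
  0 < epsilon -> u <= v ->
  u + Num.sqrt (u ^+ 2 + epsilon) <= v + Num.sqrt (v ^+ 2 + epsilon).
Proof.
move=> e0 uv.
have sqrE (t : R) : Num.sqrt (t ^+ 2 + epsilon) ^+ 2 = t ^+ 2 + epsilon.
  by rewrite sqr_sqrtr// addr_ge0 ?sqr_ge0// ltW.
have := sqrE u; have := sqrE v.
have := normr_lt_sqrt u _ e0; have := normr_lt_sqrt v _ e0.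
set A := Num.sqrt _; set B := Num.sqrt _; rewrite !ltr_norml.
move=> /andP[v1 v2] /andP[u1 u2] hA hB.
rewrite -subr_ge0 -(pmulr_lge0 _ (_ : 0 < A + B)); last by lra.
(* Both factors on the right are nonnegative because a square root [sqrt (t^2 + epsilon)] dominates
   [|t|]. *)
have -> : (v + A - (u + B)) * (A + B) = (v - u) * ((A + v) + (B + u)).
  transitivity ((v - u) * (A + B) + (A ^+ 2 - B ^+ 2)); first by ring.
  by rewrite hA hB; ring.
by rewrite mulr_ge0 ?subr_ge0//; lra.
Qed.

(** Since [(r - z) * (r + z) = 2 * epsilon], the hypotheses give [c <= r - z], the positive root of
    [c ^+ 2 + 2 * z * c = 2 * epsilon]. *)
Lemma gaussian_scale_calibration {R : realType} (Delta epsilon z sigma c : R) :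
  0 < Delta -> 0 < epsilon ->
  Delta / (2 * epsilon) * (z + Num.sqrt (z ^+ 2 + 2 * epsilon)) <= sigma ->
  0 <= c -> c * sigma <= Delta -> c * z + c ^+ 2 / 2 <= epsilon.
Proof.
move=> D0 e0.
have hr : Num.sqrt (z ^+ 2 + 2 * epsilon) ^+ 2 = z ^+ 2 + 2 * epsilon.
  by rewrite sqr_sqrtr// addr_ge0 ?sqr_ge0// mulr_ge0// ltW.
have e20 : 0 < 2 * epsilon by rewrite mulr_gt0.
have := normr_lt_sqrt z _ e20.
move: hr; set r := Num.sqrt _ => hr; rewrite ltr_norml => /andP[zr1 zr2].
move=> hs c0 hc.
have : c * (Delta / (2 * epsilon) * (z + r)) <= Delta.
  exact: le_trans (ler_wpM2l c0 hs) hc.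
have -> : c * (Delta / (2 * epsilon) * (z + r)) =
    Delta * (c * (z + r) / (2 * epsilon)) by field; lra.
rewrite -{2}[Delta]mulr1 ler_pM2l// ler_pdivrMr ?mulr_gt0// mul1r => h.
have : c <= r - z by rewrite -(ler_pM2r (_ : 0 < z + r)); nra.
nra.
Qed.

Lemma gaussian_mechanism_private {R : realType} {V : choiceType}
    (q : database V -> R) (Delta : R) {d : measure_display}
    {T : measurableType d} (P : probability T R) (Z : {RV P >-> R})
    (epsilon z sigma : R) :
  (forall x y, neighboring (x, y) -> `|q x - q y| <= Delta) ->
  standard_gaussian Z -> 0 < epsilon ->
  Delta / (2 * epsilon) * (z + Num.sqrt (z ^+ 2 + 2 * epsilon)) <= sigma ->
  differentially_private epsilon (1 - gaussian_cdf z)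
    (gaussian_mechanism Z q sigma).
Proof.
move=> hq hZ e0 hsigma S mS x y /hq hxy.
have maff (a : R) : measurable_fun setT ((fun t => a + sigma * t) : R -> R).
  by apply: measurable_funD => //; exact: measurable_funM.
have mpre (a : R) : measurable ((fun t => a + sigma * t) @^-1` S).
  by rewrite -[X in measurable X]setTI; exact: maff.
have PE a : P (gaussian_mechanism Z q sigma a @^-1` S) =
    normal_prob 0 1 ((fun t => q a + sigma * t) @^-1` S).
  by rewrite -hZ.
rewrite !PE.
(* Equal query values give equal output laws; otherwise [Delta], [sigma] and [|c|] are positive. *)
have [->|qxy] := eqVneq (q x) (q y).
  rewrite -[leLHS]adde0 leeD ?lee_fin ?subr_ge0 ?gaussian_cdf_le1//.
  by rewrite -[leLHS]mul1e lee_wpmul2r// lee_fin -[leLHS]expR0 ler_expR ltW.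
have D0 : 0 < Delta.
  by apply: lt_le_trans hxy; rewrite normr_gt0 subr_eq0.
have s0 : 0 < sigma.
  apply: lt_le_trans hsigma; rewrite mulr_gt0 ?divr_gt0 ?mulr_gt0//.
  have e20 : 0 < 2 * epsilon by rewrite mulr_gt0.
  have := normr_lt_sqrt z _ e20; rewrite ltr_norml => /andP[]; lra.
pose c := (q x - q y) / sigma.
have sc : c * sigma = q x - q y by rewrite /c divfK ?gt_eqF.
have c0 : c != 0 by rewrite mulf_neq0 ?subr_eq0// invr_neq0 ?gt_eqF.
(* In units of the noise, changing the database is a translation by [c]. *)
have -> : (fun t => q x + sigma * t) @^-1` S =
    (fun t => t + c) @^-1` ((fun t => q y + sigma * t) @^-1` S).
  rewrite -comp_preimage; congr (_ @^-1` S); apply/funext => t /=.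
  by rewrite mulrDr [sigma * c]mulrC sc; ring.
apply: le_trans (normal_prob01_shift_le c epsilon _ (mpre _)) _.
apply: leeD => //; apply: normal_prob01_loss_tail => //.
rewrite -[c ^+ 2]real_normK ?num_real//.
apply: gaussian_scale_calibration D0 e0 hsigma _ _ => //.
by rewrite -(gtr0_norm s0) -normrM sc.
Qed.

(** * Explicit bounds on the scale *)

(** Puts [b] in the form [u + sqrt (u^2 + epsilon)], monotone in [u = z / sqrt 2]. *)
Lemma gaussian_scaleE {R : realType} (Delta epsilon z : R) : 0 < epsilon ->
  Delta / (2 * epsilon) * (z + Num.sqrt (z ^+ 2 + 2 * epsilon)) =
  Delta / (epsilon * Num.sqrt 2) *
    (z / Num.sqrt 2 + Num.sqrt ((z / Num.sqrt 2) ^+ 2 + epsilon)).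
Proof.
move=> e0; have w2 : Num.sqrt (2 : R) ^+ 2 = 2 by rewrite sqr_sqrtr.
have w0 : 0 < Num.sqrt (2 : R) by rewrite sqrtr_gt0.
have -> : z ^+ 2 + 2 * epsilon =
    Num.sqrt 2 ^+ 2 * ((z / Num.sqrt 2) ^+ 2 + epsilon).
  by rewrite mulrDr -exprMn [_ * (z / _)]mulrC divfK ?gt_eqF// w2.
rewrite sqrtrM ?sqr_ge0// sqrtr_sqr gtr0_norm//.
move: w2 w0; set w := Num.sqrt 2; set t := Num.sqrt _ => <- w0.
by field; rewrite !gt_eqF.
Qed.

Theorem theorem5 (R : realType) (V : choiceType)
    (q : database V -> R) (Delta : R) (hq : global_sensitivity q Delta)
    (d : measure_display) (T : measurableType d) (P : probability T R)
    (Z : {RV P >-> R}) (hZ : standard_gaussian Z)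
    (delta epsilon : R) (hdelta0 : 0 < delta) (hdelta1 : delta < 1)
    (hepsilon : 0 < epsilon) :
  let z := gaussian_quantile (1 - delta) in
  let b := Delta / (2 * epsilon) * (z + Num.sqrt (z ^+ 2 + 2 * epsilon)) in
  let L := ln (1 / (4 * delta * (1 - delta))) in
  (forall sigma : R, b <= sigma ->
     differentially_private epsilon delta (gaussian_mechanism Z q sigma))
  /\
  (forall a s : R,
     (delta <= 1 / 2 /\ a = 1 /\ s = 1) \/
     (1 / 2 <= delta /\ a = pi / 4 /\ s = - 1) ->
     b <= Delta / (epsilon * Num.sqrt 2)
            * (Num.sqrt (a * L + epsilon) + s * Num.sqrt (a * L))
     /\
     Delta / (epsilon * Num.sqrt 2)
            * (Num.sqrt (a * L + epsilon) + s * Num.sqrt (a * L))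
       <= Delta / (epsilon * Num.sqrt 2) * (1 + s) * Num.sqrt (a * L)
          + Delta / Num.sqrt (2 * epsilon)).
Proof.
move=> z b L.
have Phi_z : gaussian_cdf z = 1 - delta.
  by apply: gaussian_quantileK; rewrite ?subr_gt0// ltrBlDr ltrDl.
have [[[x y] /= hxy Delta_eq] ub] := hq.
have Delta0 : 0 <= Delta by rewrite -Delta_eq.
split=> [sigma hsigma|a s has].
  rewrite (_ : delta = 1 - gaussian_cdf z); last by rewrite Phi_z; ring.
  apply: gaussian_mechanism_private hsigma => // u v huv.
  by apply: ub; exists (u, v).
have var_gt0 : 0 < 4 * delta * (1 - delta) by rewrite !mulr_gt0 ?subr_gt0.
have LE : L = - ln (4 * delta * (1 - delta)) by rewrite /L div1r lnV ?posrE.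
have L0 : 0 <= L.
  by rewrite LE oppr_ge0 ln_le0//; nra.
have central_z : central_prob z = 1 - 2 * delta.
  by rewrite /central_prob Phi_z; ring.
have sqrt2_gt0 : 0 < Num.sqrt (2 : R) by rewrite sqrtr_gt0.
have sqr_div_sqrt2 : (z / Num.sqrt 2) ^+ 2 = z ^+ 2 / 2.
  by rewrite expr_div_n sqr_sqrtr.
have a0 : 0 <= a.
  by case: has => [[_ [-> _]]|[_ [-> _]]]//; rewrite divr_ge0 ?pi_ge0.
have scale_ge0 : 0 <= Delta / (epsilon * Num.sqrt 2).
  by rewrite divr_ge0// mulr_ge0// ltW.
have aL0 : 0 <= a * L by rewrite mulr_ge0.
have sqrE : (s * Num.sqrt (a * L)) ^+ 2 = a * L.
  rewrite exprMn sqr_sqrtr//.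
  by case: has => [[_ [_ ->]]|[_ [_ ->]]]; rewrite ?sqrrN expr1n mul1r.
split.
  rewrite /b gaussian_scaleE//; apply: ler_wpM2l => //.
  (* As [s] is 1 or -1, the right side has the same form with [u = s * sqrt (a * L)], so only the
     values of [u] need comparing. *)
  rewrite [leRHS]addrC -[X in _ <= _ + Num.sqrt (X + epsilon)]sqrE.
  apply: add_sqrt_sqr_le => //.
  case: has => [[hdelta [aE sE]]|[hdelta [aE sE]]]; rewrite aE sE.
    have z0 : 0 <= z.
      rewrite leNgt; apply/negP => /gaussian_cdf_lt.
      by rewrite Phi_z gaussian_cdf0; lra.
    have -> : z / Num.sqrt 2 = Num.sqrt (z ^+ 2 / 2).
      by rewrite -sqr_div_sqrt2 sqrtr_sqr ger0_norm// divr_ge0// ltW.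
    rewrite !mul1r ler_wsqrtr//.
    (* Here [1 - (1 - 2 * delta) ^+ 2 = 4 * delta * (1 - delta) = expR (- L)], hence
       [z ^+ 2 / 2 <= L]. *)
    have := central_prob_sqr_ge z z0; rewrite central_z => hc.
    have : expR (- 2^-1 * z ^+ 2) >= 4 * delta * (1 - delta) by lra.
    rewrite -[leLHS]lnK ?posrE// ler_expR LE; lra.
  have z0 : z <= 0.
    rewrite leNgt; apply/negP => /gaussian_cdf_lt.
    by rewrite Phi_z gaussian_cdf0; lra.
  have -> : z / Num.sqrt 2 = - Num.sqrt (z ^+ 2 / 2).
    rewrite -sqr_div_sqrt2 sqrtr_sqr ler0_norm ?opprK//.
    by rewrite mulr_le0_ge0// invr_ge0 ltW.
  rewrite mulN1r lerN2 ler_wsqrtr//.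
  (* For [z <= 0] the sign reverses the comparison: a lower bound on [z ^+ 2] is needed, and the
     other inequality, taken at [- z], supplies it. *)
  have := central_prob_sqr_le (- z); rewrite oppr_ge0 => /(_ z0).
  rewrite central_probN (sqrrN (central_prob z)) (sqrrN z) central_z => hc.
  have : expR (- (2 / pi) * z ^+ 2) <= 4 * delta * (1 - delta).
    lra.
  rewrite -[leRHS]lnK ?posrE// ler_expR -[leRHS]opprK -LE mulNr lerN2 => hL.
  apply: le_trans (ler_wpM2l _ hL) _; first by rewrite divr_ge0 ?pi_ge0.
  have -> // : pi / 4 * (2 / pi * z ^+ 2) = z ^+ 2 / 2.
  move: (@pi_gt0 R); move: pi => p p0; by field; rewrite gt_eqF.
have -> : Delta / Num.sqrt (2 * epsilon) =
    Delta / (epsilon * Num.sqrt 2) * Num.sqrt epsilon.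
  rewrite sqrtrM// -{2}[epsilon]sqr_sqrtr ?ltW//.
  have : 0 < Num.sqrt epsilon by rewrite sqrtr_gt0.
  move: (Num.sqrt 2) sqrt2_gt0 (Num.sqrt epsilon) => w w0 t t0.
  by field; rewrite !gt_eqF.
rewrite -[X in _ <= X + _]mulrA -[leRHS]mulrDr; apply: ler_wpM2l => //.
rewrite mulrDl mul1r addrAC lerD2r.
(* Subadditivity of the square root, by comparing squares. *)
rewrite -[leRHS]ger0_norm ?addr_ge0 ?sqrtr_ge0// -sqrtr_sqr ler_wsqrtr//.
rewrite sqrrD (sqr_sqrtr aL0) (sqr_sqrtr (ltW hepsilon)) lerD2r lerDl.
by rewrite mulrn_wge0// mulr_ge0 ?sqrtr_ge0.
Qed.
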